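(* Let $m,n$ be positive integers and let $\textit{PASM}(m,n)\subseteq\mathbb{R}^{mn}$ be the convex hull of all $m\times n$ partial alternating sign matrices. Then $\textit{PASM}(m,n)$ consists exactly of all $m\times n$ real matrices $X=(X_{ij})$ such that \[ 0\le \sum_{i'=1}^{i} X_{i'j}\le 1 \quad\text{and}\quad 0\le \sum_{j'=1}^{j} X_{ij'}\le 1 \qquad\text{for all } 1\le i\le m,\ 1\le j\le n. \]
   Context: An $m\times n$ partial alternating sign matrix is an $m\times n$ matrix $M=(M_{ij})$ with entries in $\{-1,0,1\}$ such that $\sum_{i'=1}^{i} M_{i'j}\in\{0,1\}$ for all $1\le i\le m$, $1\le j\le n$, and $\sum_{j'=1}^{j} M_{ij'}\in\{0,1\}$ for all $1\le i\le m$, $1\le j\le n$. Matrices are regarded as vectors in $\mathbb{R}^{mn}$. *)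

(* Defs.v *)
From HB Require Import structures.
From mathcomp Require Import all_boot all_order all_algebra.
From mathcomp Require Import boolp classical_sets reals interval_inference convex.

Set Implicit Arguments.
Unset Strict Implicit.
Unset Printing Implicit Defensive.

Import Order.TTheory GRing.Theory Num.Theory.

Local Open Scope classical_set_scope.
Local Open Scope ring_scope.

Definition partial_asm (R : realType) (m n : nat) : set 'M[R]_(m, n) :=
  [set M : 'M[R]_(m, n) |
    [/\ forall i j, M i j \in [:: -1; 0; 1],
        forall (i : 'I_m) (j : 'I_n),
          \sum_(i' < m | (i' <= i)%N) M i' j \in [:: 0; 1]
      & forall (i : 'I_m) (j : 'I_n),
          \sum_(j' < n | (j' <= j)%N) M i j' \in [:: 0; 1]]].

Arguments partial_asm : clear implicits.

Definition convex_hull (R : realType) (E : lmodType R) (S : set E) : set E :=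
  smallest (@convex_set R E) S.

Definition PASM (R : realType) (m n : nat) : set 'M[R]_(m, n) :=
  convex_hull (partial_asm R m n).

Arguments PASM : clear implicits.

(* Main.v *)
Require Import Defs.
From HB Require Import structures.
From mathcomp Require Import all_boot all_order all_algebra.
From mathcomp Require Import boolp classical_sets reals interval_inference convex.
From mathcomp Require Import zify ring lra.

Set Implicit Arguments.
Unset Strict Implicit.
Unset Printing Implicit Defensive.

Import Order.TTheory GRing.Theory Num.Theory.

Local Open Scope classical_set_scope.
Local Open Scope ring_scope.

(** In terms of the corner sums [A a b], the sum of the entries of [X] in the
    first [a] rows and [b] columns, the inequalities say that horizontal and
    vertical increments of [A] lie in [0, 1].  If [0 <= x - y <= 1] then
    [floor (x + t) - floor (y + t)] is 0 or 1, so the matrix whose corner sums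
    are [floor (A a b + t)] (up to a constant) is a partial alternating sign
    matrix, for every [t].  Since [x] is the average of [floor (x + t)] over [t]
    in [0, 1], and [floor (A a b + t)] changes only at finitely many [t], the
    matrix [X] is a finite convex combination of such matrices. *)

(** Convexity is given for two points only, so an induction on the list merges each new point with
    the weighted mean of the rest. *)
Lemma convex_set_sum (R : realType) (E : lmodType R) (C : set E)
    (I : Type) (r : seq I) (w : I -> R) (v : I -> E) :
  @convex_set R E C -> (forall i, 0 <= w i) -> (forall i, C (v i)) ->
  \sum_(i <- r) w i = 1 -> C (\sum_(i <- r) w i *: v i).
Proof.
move=> convC w0 vC w1.
(* Total weight 1 rules out the empty list; [v i0] is the point of [C] needed in the base case
   below. *)
have [i0 _] : exists i0 : I, True.
  by case: r w1 => [|i r _]; [rewrite big_nil => /eqP; rewrite eq_sym oner_eq0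
                             |exists i].
have S0 (s : seq I) : 0 <= \sum_(i <- s) w i by apply: sumr_ge0.
(* Without normalisation the claim passes to tails, whose weights need not add up to 1. If they add
   up to 0, any point of [C] serves. *)
suff /(_ r) [c Cc ->] : forall s : seq I, exists2 c, C c &
    \sum_(i <- s) w i *: v i = (\sum_(i <- s) w i) *: c.
  by rewrite w1 scale1r.
elim=> [|i s [c Cc IH]]; first by exists (v i0); rewrite ?big_nil ?scale0r.
rewrite !big_cons IH; set S := \sum_(_ <- s) _.
have S_ge0 : 0 <= S by apply: S0.
have wi_ge0 := w0 i.
have [wS0|wS_neq0] := eqVneq (w i + S) 0.
  have [wi0 S_0] : w i = 0 /\ S = 0 by split; lra.
  by exists c; rewrite // wi0 S_0 addr0 !scale0r addr0.
have wS_gt0 : 0 < w i + S by rewrite lt_neqAle eq_sym wS_neq0 addr_ge0.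
have p0 : 0 <= w i / (w i + S) by rewrite divr_ge0// ltW.
have p1 : w i / (w i + S) <= 1 by rewrite ler_pdivrMr// mul1r lerDl.
pose p : {i01 R} := Itv01 p0 p1.
exists (conv p (v i : convex_lmodType E) c).
  by apply/set_mem/convC; apply/mem_set.
rewrite scalerDr !scalerA /= mulrBr mulr1 mulrC divfK//.
by congr (_ + _ *: _); ring.
Qed.

Lemma sum_ord_leq (V : nmodType) (m : nat) (i : 'I_m) (F : nat -> V) :
  \sum_(i' < m | (i' <= i)%N) F i' = \sum_(0 <= k < i.+1) F k.
Proof. by rewrite big_mkord -(big_ord_widen m F (ltn_ord i)). Qed.

Lemma big_ord_ltnS (V : nmodType) (p : nat) (i : 'I_p) (F : 'I_p -> V) :
  \sum_(k < p | (k < i.+1)%N) F k = \sum_(k < p | (k < i)%N) F k + F i.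
Proof.
rewrite (bigD1 i) //= addrC; congr (_ + _); apply: eq_bigl => k.
by rewrite ltnS [RHS]ltn_neqAle andbC.
Qed.

(** The floor is monotone, and [x <= y + 1 < floor y + 2] leaves only two values. *)
Lemma floor_incr (R : realType) (x y : R) :
  0 <= x - y <= 1 ->
  (Num.floor x)%:~R - (Num.floor y)%:~R \in [:: 0; 1 : R].
Proof.
move=> xy.
have /andP[fx xf] := floor_itv x; have /andP[fy yf] := floor_itv y.
rewrite !rmorphD /= in xf yf.
have : (Num.floor y <= Num.floor x < Num.floor y + 2).
  apply/andP; split.
    by apply: le_floor; lra.
  by rewrite -(ltr_int R) rmorphD /=; lra.
move=> /andP[yx xy2].
have : (Num.floor x == Num.floor y) || (Num.floor x == Num.floor y + 1) by lia.
by case/orP => /eqP ->; rewrite !inE ?subrr ?eqxx// rmorphD /= addrAC subrr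
  add0r eqxx orbT.
Qed.

(** Adding [1 - s] reaches the next integer exactly when the fractional part of [x] is at least
    [s]. *)
Lemma floor_threshold (R : realType) (x s : R) : 0 <= s <= 1 ->
  Num.floor (x + (1 - s)) =
  Num.floor x + (s <= x - (Num.floor x)%:~R)%R%:R.
Proof.
move=> s01; have /andP[fx xf] := floor_itv x; rewrite rmorphD /= in xf.
apply: floor_def; rewrite !rmorphD /=.
by have [h|h] := leP s (x - (Num.floor x)%:~R); rewrite /= ?mulr1z ?mulr0z; lra.
Qed.

(** This is the integral of [floor (x + t)] over [0, 1], with [t = 1 - u], as a Riemann sum at right
    endpoints. It is exact: as a function of [u] the integrand jumps only just after the fractional
    part of [x], which is a grid point. *)
Lemma sum_floor_threshold (R : realType) (s : seq R) (x : R) (K : nat) :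
  sorted <=%R s -> size s = K.+1 -> s`_0 = 0 -> s`_K = 1 ->
  all (fun y : R => 0 <= y <= 1) s -> x - (Num.floor x)%:~R \in s ->
  \sum_(k < K) (s`_k.+1 - s`_k) * (Num.floor (x + (1 - s`_k.+1)))%:~R = x.
Proof.
move=> s_le sK s0 s1 s01 xs; set f := x - _ in xs *.
have fE : f = x - (Num.floor x)%:~R by [].
have /andP[f0 f1] := allP s01 _ xs.
rewrite -(big_mkord xpredT (fun k =>
  (s`_k.+1 - s`_k) * (Num.floor (x + (1 - s`_k.+1)))%:~R)).
(* No element of [s] lies strictly between [s`_k] and [s`_k.+1], so the k-th
   term is the increment of [F], even where [s] is not strictly increasing. *)
pose F k : R := s`_k * (Num.floor x)%:~R + Num.min s`_k f.
rewrite (eq_big_nat _ _ (F2 := fun k => F k.+1 - F k)).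
  by rewrite telescope_sumr// /F s0 s1 (min_idPl f0) (min_idPr f1) fE; ring.
move=> k /andP[_ kK].
have lek : s`_k <= s`_k.+1 by apply: le_sorted_leq_nth; rewrite ?inE ?sK //; lia.
have : (s`_k.+1 <= f) || (f <= s`_k).
  move: (index_mem f s); rewrite xs sK => idx.
  rewrite -(nth_index 0 xs); case: (leqP (index f s) k) => h.
    by apply/orP; right; apply: le_sorted_leq_nth; rewrite ?inE ?sK //; lia.
  by apply/orP; left; apply: le_sorted_leq_nth; rewrite ?inE ?sK //; lia.
rewrite floor_threshold -/f; last by apply: (allP s01); rewrite mem_nth // sK.
rewrite /F rmorphD /=; have [h _|h fk] := leP s`_k.+1 f.
  by rewrite (min_idPl (le_trans lek h)) /= mulr1z; ring.
by rewrite (min_idPr fk) /= mulr0z; ring.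
Qed.

Section CornerSums.
Variables (R : realType) (m n : nat) (X : 'M[R]_(m, n)).
Hypothesis X01 : forall (i : 'I_m) (j : 'I_n),
  0 <= \sum_(i' < m | (i' <= i)%N) X i' j <= 1 /\
  0 <= \sum_(j' < n | (j' <= j)%N) X i j' <= 1.

(** Strict bounds and indices in [nat] provide a zero row and a zero column, so that differences
    need no boundary case. *)
Definition corner_sum (a b : nat) : R :=
  \sum_(i < m | (i < a)%N) \sum_(j < n | (j < b)%N) X i j.

Lemma corner_sum0l b : corner_sum 0 b = 0.
Proof. by rewrite /corner_sum big_pred0. Qed.

Lemma corner_sum0r a : corner_sum a 0 = 0.
Proof. by rewrite /corner_sum big1// => i _; rewrite big_pred0. Qed.

Lemma corner_sumSl (i : 'I_m) b :
  corner_sum i.+1 b = corner_sum i b + \sum_(j < n | (j < b)%N) X i j.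
Proof. by rewrite /corner_sum big_ord_ltnS. Qed.

Lemma corner_sumSr a (j : 'I_n) :
  corner_sum a j.+1 = corner_sum a j + \sum_(i < m | (i < a)%N) X i j.
Proof.
by rewrite /corner_sum -big_split /=; apply: eq_bigr => i _; rewrite big_ord_ltnS.
Qed.

Lemma corner_sum_incrl (i : 'I_m) b : (b <= n)%N ->
  0 <= corner_sum i.+1 b - corner_sum i b <= 1.
Proof.
case: b => [_|b bn]; first by rewrite !corner_sum0r; lra.
by rewrite corner_sumSl addrAC subrr add0r; have [_] := X01 i (Ordinal bn).
Qed.

Lemma corner_sum_incrr a (j : 'I_n) : (a <= m)%N ->
  0 <= corner_sum a j.+1 - corner_sum a j <= 1.
Proof.
case: a => [_|a am]; first by rewrite !corner_sum0l; lra.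
by rewrite corner_sumSr addrAC subrr add0r; have [] := X01 (Ordinal am) j.
Qed.

Lemma corner_sumK (i : 'I_m) (j : 'I_n) :
  X i j = corner_sum i.+1 j.+1 - corner_sum i j.+1
          - (corner_sum i.+1 j - corner_sum i j).
Proof. by rewrite !corner_sumSl big_ord_ltnS; ring. Qed.

Definition rounded_corner (t : R) (a b : nat) : R :=
  (Num.floor (corner_sum a b + t))%:~R.

(** The mixed difference inverts corner summation. It also cancels the constant [floor t] that
    [rounded_corner] takes on row 0 and column 0. *)
Definition rounding (t : R) : 'M[R]_(m, n) :=
  \matrix_(i, j) (rounded_corner t i.+1 j.+1 - rounded_corner t i j.+1
                  - (rounded_corner t i.+1 j - rounded_corner t i j)).

Lemma rounded_corner_incrl t (i : 'I_m) b : (b <= n)%N ->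
  rounded_corner t i.+1 b - rounded_corner t i b \in [:: 0; 1].
Proof.
by move=> bn; apply: floor_incr; have := corner_sum_incrl i bn; lra.
Qed.

Lemma rounded_corner_incrr t a (j : 'I_n) : (a <= m)%N ->
  rounded_corner t a j.+1 - rounded_corner t a j \in [:: 0; 1].
Proof.
by move=> am; apply: floor_incr; have := corner_sum_incrr j am; lra.
Qed.

(** Partial column and row sums telescope to single increments of [rounded_corner], and an entry is
    the difference of two such increments. *)
Lemma rounding_partial_asm t : partial_asm R m n (rounding t).
Proof.
split=> i j.
- rewrite mxE.
  have := rounded_corner_incrl t i (ltnW (ltn_ord j)).
  have := rounded_corner_incrl t i (ltn_ord j).
  by rewrite !inE => /orP[] /eqP -> /orP[] /eqP ->;
    rewrite ?subrr ?subr0 ?sub0r ?eqxx ?orbT.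
- pose F (a : nat) := rounded_corner t a j.+1 - rounded_corner t a j.
  rewrite (eq_bigr (fun i' : 'I_m => F i'.+1 - F i')); last first.
    by move=> i' _; rewrite mxE /F; ring.
  rewrite (sum_ord_leq i (fun k => F k.+1 - F k)) telescope_sumr //.
  (* The lower boundary term is [floor t - floor t], hence 0. *)
  by rewrite {2}/F /rounded_corner !corner_sum0l subrr subr0 rounded_corner_incrr.
- pose F (b : nat) := rounded_corner t i.+1 b - rounded_corner t i b.
  rewrite (eq_bigr (fun j' : 'I_n => F j'.+1 - F j')); last first.
    by move=> j' _; rewrite mxE.
  rewrite (sum_ord_leq j (fun k => F k.+1 - F k)) telescope_sumr //.
  by rewrite {2}/F /rounded_corner !corner_sum0r subrr subr0 rounded_corner_incrl.
Qed.

Lemma polytope_sub_convex (C : set 'M[R]_(m, n)) :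
  @convex_set R 'M[R]_(m, n) C -> partial_asm R m n `<=` C -> C X.
Proof.
move=> convC asmC.
pose frac (x : R) := x - (Num.floor x)%:~R.
have frac01 x : 0 <= frac x <= 1.
  have /andP[fx xf] := floor_itv x; rewrite rmorphD /= in xf.
  by rewrite /frac; lra.
(* One grid holds the fractional parts of all corner sums, so the same weights average correctly at
   every corner. Repeated values only give weight 0. *)
pose l := [:: 0; 1] ++
  [seq frac (corner_sum p.1 p.2) | p : 'I_m.+1 * 'I_n.+1].
pose s : seq R := sort <=%R l; pose K := (size l).-1.
have s_le : sorted <=%R s by apply: sort_le_sorted.
have sK : size s = K.+1 by rewrite size_sort.
have s01 : all (fun y : R => 0 <= y <= 1) s.
  rewrite all_sort /l /= lexx ler01 lexx /=.
  by apply/allP => y /mapP[p _ ->].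
have s_mem (y : R) : y \in l -> y \in s by rewrite mem_sort.
have s0 : s`_0 = 0.
  have s00 : (0 : R) \in s by apply: s_mem; rewrite !inE eqxx.
  apply/eqP; rewrite eq_le; apply/andP; split; last first.
    by have /andP[] : 0 <= s`_0 <= 1 by apply: (allP s01); rewrite mem_nth ?sK.
  have lt0 : (index 0%R s < K.+1)%N by rewrite -sK index_mem.
  rewrite -[leRHS](nth_index 0 s00).
  by apply: le_sorted_leq_nth; rewrite ?inE ?sK.
have s1 : s`_K = 1.
  have s11 : (1 : R) \in s by apply: s_mem; rewrite !inE eqxx orbT.
  apply/eqP; rewrite eq_le; apply/andP; split.
    by have /andP[] : 0 <= s`_K <= 1 by apply: (allP s01); rewrite mem_nth ?sK.
  have lt1 : (index 1%R s < K.+1)%N by rewrite -sK index_mem.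
  rewrite -[leLHS](nth_index 0 s11).
  by apply: le_sorted_leq_nth; rewrite ?inE ?sK.
have avg a b : (a <= m)%N -> (b <= n)%N ->
    \sum_(k < K) (s`_k.+1 - s`_k) * rounded_corner (1 - s`_k.+1) a b =
    corner_sum a b.
  move=> am bn; apply: sum_floor_threshold => //; apply: s_mem.
  rewrite mem_cat; apply/orP; right; apply/mapP.
  by exists (inord a, inord b); rewrite ?mem_enum //= !inordK.
(* Entries are linear in corner sums, so the averaging identity passes from the four corners around
   an entry to the entry. *)
have -> : X = \sum_(k < K) (s`_k.+1 - s`_k) *: rounding (1 - s`_k.+1).
  apply/matrixP => i j; rewrite corner_sumK -!avg // ?(ltnW (ltn_ord _)) //.
  rewrite -!sumrB summxE; apply: eq_bigr => k _; rewrite !mxE; ring.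
apply: (convex_set_sum convC) => [k|k|].
- rewrite subr_ge0; have kK := ltn_ord k.
  by apply: le_sorted_leq_nth; rewrite ?inE ?sK ?ltnS ?(ltnW kK).
- exact/asmC/rounding_partial_asm.
- rewrite -(big_mkord xpredT (fun k => s`_k.+1 - s`_k)) telescope_sumr //.
  by rewrite s0 s1 subr0.
Qed.

End CornerSums.

Lemma conv01 (R : realType) (p : {i01 R}) (x y : R) :
  0 <= x <= 1 -> 0 <= y <= 1 ->
  0 <= p%:inum * x + (1 - p%:inum) * y <= 1.
Proof.
move=> x01 y01.
have p0 : 0 <= p%:inum by [].
have p1 : p%:inum <= 1 by [].
by apply/andP; split; nra.
Qed.

Theorem theorem4p6 (R : realType) (m n : nat)
    (m_gt0 : (0 < m)%N) (n_gt0 : (0 < n)%N) :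
  PASM R m n =
  [set X : 'M[R]_(m, n) | forall (i : 'I_m) (j : 'I_n),
     0 <= \sum_(i' < m | (i' <= i)%N) X i' j <= 1 /\
     0 <= \sum_(j' < n | (j' <= j)%N) X i j' <= 1].
Proof.
apply/seteqP; split.
(* By minimality of the hull, it suffices that the polytope is convex and contains the partial
   alternating sign matrices. *)
- apply: smallest_sub.
  + move=> X Y p /set_mem XP /set_mem YP; apply/mem_set => i j.
    have [Xc Xr] := XP i j; have [Yc Yr] := YP i j.
    under eq_bigr do rewrite !mxE.
    under [X in _ /\ 0 <= X <= 1]eq_bigr do rewrite !mxE.
    by rewrite !big_split /= -!mulr_sumr; split; apply: conv01.
  + move=> M [_ col row] i j; split.
    * by have := col i j; rewrite !inE => /orP[] /eqP ->; rewrite lexx ler01.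
    * by have := row i j; rewrite !inE => /orP[] /eqP ->; rewrite lexx ler01.
- by move=> X X01 C [convC asmC]; apply: polytope_sub_convex.
Qed.
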